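(* Let $K$ be a field. Every finite dimensional representation $(V,G)$ over $K$ (that is, $G$ is a group and $V$ is a right $KG$-module with $\dim_K V<\infty$) is action type geometrically Noetherian.
   Context: A homomorphism of representations $(\alpha,\beta):(V,G)\to(W,H)$ is a $K$-module homomorphism $\alpha:V\to W$ together with a group homomorphism $\beta:G\to H$ such that $(v\circ g)^\alpha=v^\alpha\circ g^\beta$ for all $v\in V$, $g\in G$. For finite sets $X,Y$ let $F(Y)$ be the free group on $Y$, $XKF(Y)=\bigoplus_{x\in X}xKF(Y)$ the free right $KF(Y)$-module with basis $X$, and $W(X,Y)=(XKF(Y),F(Y))$. For $T\subset XKF(Y)$ put $T^{\nabla}_{(V,G)}=\{(\alpha,\beta)\in\mathrm{Hom}(W(X,Y),(V,G))\mid \ker\alpha\supset T\}$. The representation $(V,G)$ is called action type geometrically Noetherian if for all finite sets $X,Y$ and every $T\subset XKF(Y)$ there is a finite subset $T_0\subset T$ with $(T_0)^{\nabla}_{(V,G)}=T^{\nabla}_{(V,G)}$. *)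

(* Defs.v *)
From HB Require Import structures.
From mathcomp Require Import all_boot all_algebra.
From mathcomp Require Import finmap monalg.
From mathcomp Require Import boolp classical_sets cardinality.

Set Implicit Arguments.
Unset Strict Implicit.
Unset Printing Implicit Defensive.

Import GRing.Theory.

Local Open Scope ring_scope.

(* The free group F(Y): reduced words in the letters y = (y, true) and
   y^-1 = (y, false), multiplied by concatenation and cancellation. *)
Section FreeGroup.
Variable Y : choiceType.
Implicit Types (a b : Y * bool) (u v w : seq (Y * bool)).

Definition letter_inv a : Y * bool := (a.1, ~~ a.2).

Definition reduced w : bool := sorted (fun a b => b != letter_inv a) w.

Definition push_letter a w : seq (Y * bool) :=
  if w is b :: w' then if b == letter_inv a then w' else a :: w else [:: a].

Definition reduced_mul u v : seq (Y * bool) := foldr push_letter v u.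

Definition reduced_inv u : seq (Y * bool) := rev (map letter_inv u).

Lemma letter_invK : involutive letter_inv.
Proof. by case=> y b; rewrite /letter_inv /= negbK. Qed.

Lemma reduced_push a w : reduced w -> reduced (push_letter a w).
Proof.
case: w => [|b w] //= rw; case: ifP => [_|/negbT ba]; last by rewrite /= ba.
exact: path_sorted rw.
Qed.

Lemma push_letterK a w :
  reduced w -> push_letter a (push_letter (letter_inv a) w) = w.
Proof.
case: w => [|b w] /=; first by rewrite eqxx.
rewrite letter_invK; case: eqVneq => [->|ba] rw /=; last by rewrite eqxx.
by case: w rw => [|c w] //= /andP[/negPf ->].
Qed.

Lemma reduced_mulP u v : reduced v -> reduced (reduced_mul u v).
Proof. by move=> rv; elim: u => //= a u; apply: reduced_push. Qed.

Lemma reduced_invP u : reduced u -> reduced (reduced_inv u).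
Proof.
rewrite /reduced /reduced_inv rev_sorted sorted_map.
apply: sub_sorted => a b /=; apply: contra => /eqP ->.
by rewrite letter_invK.
Qed.

Lemma reduced_mulw1 u : reduced u -> reduced_mul u [::] = u.
Proof.
elim: u => //= a u IHu rau; rewrite (IHu (path_sorted rau)).
by case: u rau {IHu} => //= b u /andP[/negPf ->].
Qed.

Lemma reduced_mul_push a u v : reduced u -> reduced v ->
  reduced_mul (push_letter a u) v = push_letter a (reduced_mul u v).
Proof.
case: u => [|b u] //= ru rv; case: eqVneq => //= ->.
by rewrite push_letterK ?reduced_mulP.
Qed.

Lemma reduced_mulA u v w : reduced v -> reduced w ->
  reduced_mul u (reduced_mul v w) = reduced_mul (reduced_mul u v) w.
Proof.
move=> rv rw; elim: u => //= a u ->.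
by rewrite reduced_mul_push ?reduced_mulP.
Qed.

Lemma reduced_mulK u v :
  reduced v -> reduced_mul (reduced_inv u) (reduced_mul u v) = v.
Proof.
move=> rv; elim: u => //= a u IHu.
rewrite /reduced_inv /= rev_cons /reduced_mul foldr_rcons.
rewrite -{2}[a]letter_invK push_letterK //; exact: reduced_mulP.
Qed.

Lemma reduced_invK : involutive reduced_inv.
Proof.
move=> u; rewrite /reduced_inv map_rev revK -map_comp map_id_in // => a _.
exact: letter_invK.
Qed.

Record freeGroup := FreeGroup { fgword : seq (Y * bool); _ : reduced fgword }.

HB.instance Definition _ := [isSub for fgword].
HB.instance Definition _ := [Choice of freeGroup by <:].

Implicit Types x y z : freeGroup.

Definition fg_one := @FreeGroup [::] isT.
Definition fg_mul x y := FreeGroup (reduced_mulP (val x) (valP y)).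
Definition fg_inv x := FreeGroup (reduced_invP (valP x)).

Fact fg_mulA : associative fg_mul.
Proof.
move=> x y z; apply: val_inj.
by rewrite /= reduced_mulA ?(valP y, valP z).
Qed.
Fact fg_mul1 : left_id fg_one fg_mul.
Proof. by move=> x; apply: val_inj. Qed.
Fact fg_mulr1 : right_id fg_one fg_mul.
Proof. by move=> x; apply: val_inj; rewrite /= reduced_mulw1 ?(valP x). Qed.
Fact fg_mulV : left_inverse fg_one fg_inv fg_mul.
Proof.
move=> x; apply: val_inj => /=.
by rewrite -{2}[fgword x]reduced_mulw1 ?(valP x) // reduced_mulK.
Qed.
Fact fg_mulrV : right_inverse fg_one fg_inv fg_mul.
Proof.
move=> x; rewrite -{1}[x](_ : fg_inv (fg_inv x) = x) ?fg_mulV //.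
by apply: val_inj; rewrite /= reduced_invK.
Qed.

HB.instance Definition _ :=
  isGroup.Build freeGroup fg_mulA fg_mul1 fg_mulr1 fg_mulV fg_mulrV.

Definition fg_gen (y : Y) : freeGroup := @FreeGroup [:: (y, true)] isT.

End FreeGroup.

Section FreeGroupUniversal.
Variables (Y : choiceType) (G : groupType) (f : Y -> G).
Local Open Scope group_scope.

Definition letter_val (a : Y * bool) : G := if a.2 then f a.1 else (f a.1)^-1.

Definition fg_lift (x : freeGroup Y) : G :=
  foldr (fun a g => letter_val a * g) 1 (fgword x).

Lemma letter_valV a : letter_val (letter_inv a) = (letter_val a)^-1.
Proof. by case: a => y [] //=; rewrite /letter_val /= invgK. Qed.

Lemma fg_lift_subproof : monoid.monoid_morphism fg_lift.
Proof.
split=> // x y; rewrite /fg_lift /=.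
elim: (fgword x) => [|a u IHu] /=; first by rewrite mul1g.
rewrite -mulgA -IHu /push_letter.
case: (reduced_mul u _) => [|b v] //=; case: eqP => //= ->.
by rewrite letter_valV mulVKg.
Qed.

HB.instance Definition _ :=
  isUMagmaMorphism.Build (freeGroup Y) G fg_lift fg_lift_subproof.

Lemma fg_lift_gen y : fg_lift (fg_gen y) = f y.
Proof. exact: mulg1. Qed.

Lemma fg_lift_unique (h : UMagmaMorphism.type (freeGroup Y) G) :
  (forall y, h (fg_gen y) = f y) -> h =1 fg_lift.
Proof.
move=> hf [u ru]; rewrite /fg_lift /=.
elim: u ru => [|[y b] u IHu] ru /=.
  by rewrite -[RHS](@gmulf1 _ _ h); congr (h _); apply: val_inj.
have ru' := path_sorted ru.
rewrite -(IHu ru').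
have hy : h (@FreeGroup _ [:: (y, b)] isT) = letter_val (y, b).
  case: b {ru} => //=; first exact: hf.
  rewrite /letter_val /= -hf -gmulfV; congr (h _); exact: val_inj.
rewrite -hy -gmulfM; congr (h _); apply: val_inj => /=.
by case: u ru {IHu ru'} => //= b' u /andP[/negPf ->].
Qed.

End FreeGroupUniversal.

(* The group algebra KG: finitely supported functions G -> K under
   convolution. [monalg] only multiplies over monoids without nontrivial units,
   so its ring structure does not apply here. *)
Definition groupAlgebra (K : comNzRingType) (G : groupType) : Type :=
  {malg K[G]}.

Section GroupAlgebra.
Variables (K : comNzRingType) (G : groupType).
Implicit Types (g p q : {malg K[G]}).

HB.instance Definition _ := GRing.Lmodule.on (groupAlgebra K G).

Definition ga_one : {malg K[G]} := << 1%g >>.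
Definition ga_mul p q : {malg K[G]} :=
  \sum_(g <- msupp p) \sum_(h <- msupp q) << p@_g * q@_h *g (g * h)%g >>.

Local Open Scope fset_scope.

Lemma ga_mulw (d1 d2 : {fset G}) p q :
  msupp p `<=` d1 -> msupp q `<=` d2 ->
  ga_mul p q = \sum_(g <- d1) \sum_(h <- d2) << p@_g * q@_h *g (g * h)%g >>.
Proof.
move=> le_d1 le_d2; rewrite /ga_mul (big_fset_incl _ le_d1) /=.
  apply/eq_bigr=> g _; apply/big_fset_incl => // h _ /mcoeff_outdom ->.
  by rewrite mulr0 monalgU0.
move=> g _ /mcoeff_outdom pg.
by rewrite big1 => // h _; rewrite pg mul0r monalgU0.
Qed.

Lemma ga_mulUU c1 c2 (g1 g2 : G) :
  ga_mul << c1 *g g1 >> << c2 *g g2 >> = << c1 * c2 *g (g1 * g2)%g >>.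
Proof. by rewrite (ga_mulw msuppU_le msuppU_le) !big_seq_fset1 !mcoeffUU. Qed.

Fact ga_mulDl : left_distributive ga_mul +%R.
Proof.
move=> p1 p2 q; pose d := msupp p1 `|` msupp p2.
rewrite (@ga_mulw d (msupp q) p1) ?fsubsetUl //.
rewrite (@ga_mulw d (msupp q) p2) ?fsubsetUr //.
rewrite (@ga_mulw d (msupp q)) ?msuppD_le // -big_split; apply/eq_bigr => g _.
rewrite -big_split; apply/eq_bigr => h _ /=.
by rewrite mcoeffD mulrDl monalgUD.
Qed.

Fact ga_mulDr : right_distributive ga_mul +%R.
Proof.
move=> q p1 p2; pose d := msupp p1 `|` msupp p2.
rewrite (@ga_mulw (msupp q) d _ p1) ?fsubsetUl //.
rewrite (@ga_mulw (msupp q) d _ p2) ?fsubsetUr //.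
rewrite (@ga_mulw (msupp q) d) ?msuppD_le // -big_split; apply/eq_bigr => g _.
rewrite -big_split; apply/eq_bigr => h _ /=.
by rewrite mcoeffD mulrDr monalgUD.
Qed.

Lemma ga_mul0 p : ga_mul 0 p = 0.
Proof. by rewrite /ga_mul msupp0 big_seq_fset0. Qed.
Lemma ga_mulr0 p : ga_mul p 0 = 0.
Proof. by rewrite /ga_mul big1 // => g _; rewrite msupp0 big_seq_fset0. Qed.

Lemma ga_mul_suml I (r : seq I) (F : I -> {malg K[G]}) q :
  ga_mul (\sum_(i <- r) F i) q = \sum_(i <- r) ga_mul (F i) q.
Proof.
exact: (big_morph (ga_mul^~ q) (fun _ _ => ga_mulDl _ _ _) (ga_mul0 _)).
Qed.
Lemma ga_mul_sumr I (r : seq I) (F : I -> {malg K[G]}) q :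
  ga_mul q (\sum_(i <- r) F i) = \sum_(i <- r) ga_mul q (F i).
Proof.
exact: (big_morph (ga_mul q) (fun _ _ => ga_mulDr _ _ _) (ga_mulr0 _)).
Qed.

Fact ga_mulA : associative ga_mul.
Proof.
move=> p q r; rewrite [p]monalgE [q]monalgE.
rewrite !ga_mul_suml; apply/eq_bigr => g1 _.
rewrite 2!ga_mul_sumr ga_mul_suml; apply/eq_bigr => g2 _.
rewrite [r]monalgE !ga_mul_sumr; apply/eq_bigr => g3 _.
by rewrite !ga_mulUU mulrA mulgA.
Qed.

Fact ga_mul1 : left_id ga_one ga_mul.
Proof.
move=> p; rewrite {2}[p]monalgE {1}[p]monalgE ga_mul_sumr.
by apply/eq_bigr => g _; rewrite ga_mulUU mul1r mul1g.
Qed.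

Fact ga_mulr1 : right_id ga_one ga_mul.
Proof.
move=> p; rewrite {2}[p]monalgE {1}[p]monalgE ga_mul_suml.
by apply/eq_bigr => g _; rewrite ga_mulUU mulr1 mulg1.
Qed.

Fact ga_oner_neq0 : ga_one != 0.
Proof. by rewrite monalgU_eq0 oner_eq0. Qed.

HB.instance Definition _ := GRing.Zmodule_isNzRing.Build (groupAlgebra K G)
  ga_mulA ga_mul1 ga_mulr1 ga_mulDl ga_mulDr ga_oner_neq0.

Lemma ga_mulE (p q : groupAlgebra K G) : p * q = ga_mul p q.
Proof. by []. Qed.

Definition ga_scalar (c : K) : groupAlgebra K G := << c *g 1%g >>.
Definition ga_elt (g : G) : groupAlgebra K G := << g >>.

End GroupAlgebra.

(* A right KG-module is a left module over the converse ring of KG. *)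
Notation rightModType K G := (lmodType (groupAlgebra K G)^c).

(* The K-module underlying a right KG-module, by restriction of scalars along
   K -> KG. *)
Definition underlyingK (K : comNzRingType) (G : groupType)
  (V : rightModType K G) : Type := V.

Section Representation.
Variables (K : comNzRingType) (G : groupType) (V : rightModType K G).

(* v \o g in the notation (V, G) of representations. *)
Definition rep_act (v : V) (g : G) : V :=
  (ga_elt K g : (groupAlgebra K G)^c) *: v.

Lemma rep_act1 v : rep_act v 1%g = v.
Proof. exact: scale1r. Qed.

Lemma rep_actM v g h : rep_act (rep_act v g) h = rep_act v (g * h)%g.
Proof.
rewrite /rep_act scalerA; congr (_ *: _).
by rewrite -[LHS]/(ga_mul (ga_elt K g) (ga_elt K h)) ga_mulUU mulr1.
Qed.

Definition rep_scale (c : K) (v : underlyingK V) : underlyingK V :=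
  (ga_scalar G c : (groupAlgebra K G)^c) *: (v : V).

HB.instance Definition _ := GRing.Zmodule.on (underlyingK V).

Fact rep_scaleA a b v : rep_scale a (rep_scale b v) = rep_scale (a * b) v.
Proof.
rewrite /rep_scale scalerA; congr (_ *: _).
rewrite -[LHS]/(ga_mul (ga_scalar G b) (ga_scalar G a)).
by rewrite ga_mulUU mulg1 mulrC.
Qed.
Fact rep_scale1 : left_id 1 rep_scale.
Proof. by move=> v; apply: scale1r. Qed.
Fact rep_scaleDr : right_distributive rep_scale +%R.
Proof. by move=> c u v; apply: scalerDr. Qed.
Fact rep_scaleDl v : {morph rep_scale^~ v : a b / a + b}.
Proof.
by move=> a b; rewrite /rep_scale /ga_scalar monalgUD; apply: scalerDl.
Qed.

HB.instance Definition _ := GRing.Zmodule_isLmodule.Build K (underlyingK V)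
  rep_scaleA rep_scale1 rep_scaleDr rep_scaleDl.

Definition rep_finite_dim : Prop :=
  exists n : nat, inhabited (Vector.axiom n (underlyingK V)).

End Representation.

Record repHom (K : comNzRingType) (G H : groupType)
    (V : rightModType K G) (W : rightModType K H) := RepHom {
  rep_alpha : {linear underlyingK V -> underlyingK W};
  rep_beta : UMagmaMorphism.type G H;
  rep_homP : forall (v : V) (g : G),
    rep_alpha (rep_act v g) = rep_act (rep_alpha v : W) (rep_beta g)
}.

(* XKF(Y): the direct sum of copies of the regular right module KF(Y) indexed
   by the finite set X. *)
Definition freeRep (K : comNzRingType) (X Y : finType) :
    rightModType K (freeGroup Y) :=
  {ffun X -> ((groupAlgebra K (freeGroup Y))^c)^o}.

Section FreeRepTheory.
Variables (K : comNzRingType) (X Y : finType).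
Local Notation KF := (groupAlgebra K (freeGroup Y)).

Lemma freeRep_actE (w : freeRep K X Y) f x :
  (rep_act w f : {ffun X -> KF}) x = (w : {ffun X -> KF}) x * ga_elt K f.
Proof. by rewrite /rep_act ffunE. Qed.

Lemma freeRep_scaleE (c : K) (w : underlyingK (freeRep K X Y)) x :
  (c *: w : {ffun X -> KF}) x = c *: (w : {ffun X -> KF}) x.
Proof.
transitivity ((w : {ffun X -> KF}) x * ga_scalar _ c); first exact: ffunE.
set p := (w : {ffun X -> KF}) x; rewrite ga_mulE [p]monalgE ga_mul_suml.
rewrite scaler_sumr; apply: eq_bigr => f _; rewrite ga_mulUU mulg1.
by apply/malgP => k; rewrite mcoeffZ !mcoeffU mulrC mulrnAr.
Qed.

End FreeRepTheory.

Section GeometricallyNoetherian.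
Local Open Scope classical_set_scope.
Variables (K : comNzRingType) (G : groupType) (V : rightModType K G).

Definition nabla (X Y : finType) (T : set (freeRep K X Y)) :
    set (repHom (freeRep K X Y) V) :=
  [set h | T `<=` [set w | rep_alpha h w = 0]].

Definition action_type_geom_noetherian : Prop :=
  forall (X Y : finType) (T : set (freeRep K X Y)),
    exists T0 : set (freeRep K X Y),
      [/\ T0 `<=` T, finite_set T0 & nabla T0 = nabla T].

End GeometricallyNoetherian.

(* Main.v *)
(* After a choice of basis of V, a homomorphism W(X,Y) -> (V,G) is recorded by
   the coordinates of the images of the x in X and the matrices of the letters
   y and y^-1; treating the two matrices as independent unknowns makes the
   coordinates of alpha(w) polynomial in these finitely many scalars.  So T
   amounts to a system of polynomial equations over K, and by Hilbert's basis
   theorem finitely many of them generate the same ideal. *)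
From HB Require Import structures.
Require Import Defs.
From mathcomp Require Import all_boot all_algebra.
From mathcomp Require Import finmap monalg boolp classical_sets cardinality.

Set Implicit Arguments.
Unset Strict Implicit.
Unset Printing Implicit Defensive.

Import GRing.Theory.

Local Open Scope ring_scope.
Local Open Scope classical_set_scope.

(** * Ideals and the Noetherian property *)

Section Ideals.
Variable R : comNzRingType.

Definition is_ideal (J : set R) : Prop :=
  [/\ J 0, forall x y, J x -> J y -> J (x + y) & forall a x, J x -> J (a * x)].

Definition ideal_gen (A : set R) : set R := smallest is_ideal A.

(** The finite set is drawn from [A] itself, because the finite subset sought in the theorem must
    lie inside [T]. *)
Definition noetherian : Prop := forall A : set R,
  exists B : set R, [/\ B `<=` A, finite_set B & A `<=` ideal_gen B].

Lemma ideal_gen_ideal A : is_ideal (ideal_gen A).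
Proof.
split=> [J [] []|x y Ax Ay J JA|a x Ax J JA] //.
- by case: (JA) => [[_ JD _] _]; apply: JD; [apply: Ax|apply: Ay].
- by case: (JA) => [[_ _ JM] _]; apply: JM; apply: Ax.
Qed.

Lemma ideal_gen_sub A J : is_ideal J -> A `<=` J -> ideal_gen A `<=` J.
Proof. by move=> iJ AJ; apply: smallest_sub. Qed.

Lemma sub_ideal_gen A : A `<=` ideal_gen A.
Proof. exact: sub_gen_smallest. Qed.

Lemma ideal_gen_mono A B : A `<=` B -> ideal_gen A `<=` ideal_gen B.
Proof.
move=> AB; apply: ideal_gen_sub; first exact: ideal_gen_ideal.
exact: subset_trans AB (@sub_ideal_gen B).
Qed.

(** The right-hand side contains [A] and is an ideal: for a sum, take the union of the two finite
    sets. *)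
Lemma ideal_gen_finite_sub A :
  ideal_gen A `<=`
    [set x | exists B, [/\ B `<=` A, finite_set B & ideal_gen B x]].
Proof.
apply: ideal_gen_sub => [|x Ax]; last first.
  exists [set x]; split=> [_ ->//||]; first exact: finite_set1.
  exact: sub_ideal_gen.
split=> [|x y [B [BA fB Bx]] [C [CA fC Cy]]|a x [B [BA fB Bx]]].
- exists set0; split=> //; by case: (ideal_gen_ideal set0).
- exists (B `|` C); split; [by rewrite subUset|by rewrite finite_setU|].
  case: (ideal_gen_ideal (B `|` C)) => _ iD _; apply: iD.
    exact: ideal_gen_mono (@subsetUl _ B C) _ Bx.
  exact: ideal_gen_mono (@subsetUr _ B C) _ Cy.
- by exists B; split=> //; case: (ideal_gen_ideal B) => _ _; apply.
Qed.

(** Each of the finitely many generators of [ideal_gen A] involves only finitely many members of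
    [A]; the union of these is the required [B]. *)
Lemma noetherian_of_ideals :
  (forall I : set R, is_ideal I -> exists s : seq R,
     [set` s] `<=` I /\ I `<=` ideal_gen [set` s]) -> noetherian.
Proof.
move=> H A; have [s [sA As]] := H _ (ideal_gen_ideal A).
suff [B [BA fB sB]] : exists B, [/\ B `<=` A, finite_set B
    & [set` s] `<=` ideal_gen B].
  exists B; split=> // x /sub_ideal_gen /As.
  by apply: ideal_gen_sub => //; exact: ideal_gen_ideal.
elim: s sA {As} => [|x s IHs] sA; first by exists set0; split=> //.
have [|B [BA fB sB]] := IHs.
  by move=> y /= ys; apply: sA; rewrite /= inE ys orbT.
have [|C [CA fC Cx]] := @ideal_gen_finite_sub A x.
  by apply: sA; rewrite /= mem_head.
exists (B `|` C); split; [by rewrite subUset|by rewrite finite_setU|].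
move=> y /=; rewrite inE => /orP[/eqP ->|/sB By].
  exact: ideal_gen_mono (@subsetUr _ B C) _ Cx.
exact: ideal_gen_mono (@subsetUl _ B C) _ By.
Qed.

End Ideals.

(** * Hilbert's basis theorem and finitely many variables *)

Lemma field_noetherian (K : fieldType) : noetherian K.
Proof.
apply: noetherian_of_ideals => I [I0 ID IM].
have [[x Ix x0]|nI] := pselect (exists2 x, I x & x != 0).
  exists [:: x]; split=> [y|y Iy] /=; first by rewrite inE => /eqP ->.
  rewrite -[y](mulfVK x0).
  case: (ideal_gen_ideal [set` [:: x]]) => _ _; apply.
  by apply: sub_ideal_gen; rewrite /= mem_head.
exists [::]; split=> // y Iy; case: (eqVneq y 0) => [->|y0].
  by case: (ideal_gen_ideal (R := K) [set` [::]]).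
by case: nI; exists y.
Qed.

(* Otherwise pick greedily f_0, f_1, ... in I, each of least degree outside the
   ideal generated by its predecessors.  Some leading coefficient depends on
   the earlier ones, and cancelling it contradicts minimality. *)
Theorem hilbert_basis (R : comNzRingType) :
  noetherian R -> noetherian {poly R}.
Proof.
move=> nR; apply: noetherian_of_ideals => I iI; apply: contrapT => nfg.
(* The inclusion in [I] stands under the existential so that choice yields a function on all
   sequences. *)
have step (s : seq {poly R}) : exists f, [set` s] `<=` I ->
    [/\ I f, ~ ideal_gen [set` s] f & forall g, I g ->
        ~ ideal_gen [set` s] g -> (size f <= size g)%N].
  have [sI|] := pselect ([set` s] `<=` I); last by exists 0.
  have exn : exists n, `[< exists f, [/\ I f, ~ ideal_gen [set` s] f
      & size f = n] >].
    apply: contrapT => H; apply: nfg; exists s; split=> // f If.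
    by apply: contrapT => sf; apply: H; exists (size f); apply/asboolP; exists f.
  case: (ex_minnP exn) => n /asboolP[f [If sf fn]] min_n.
  exists f => _; split=> // g Ig sg; rewrite fn; apply: min_n.
  by apply/asboolP; exists g.
have [next nextP] := choice step.
(* [F k] lists the first [k] choices, latest first. *)
pose F k := iter k (fun s => next s :: s) [::].
pose f k := next (F k).
have FI k : [set` F k] `<=` I.
  elim: k => [|k IHk] g //=; rewrite inE => /orP[/eqP ->|/IHk //].
  by case: (nextP _ IHk).
have f_I k : I (f k) by case: (nextP _ (FI k)).
have fnF k : ~ ideal_gen [set` F k] (f k) by case: (nextP _ (FI k)).
have f_min k g : I g -> ~ ideal_gen [set` F k] g -> (size (f k) <= size g)%N.
  by case: (nextP _ (FI k)) => _ _; apply.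
have F_mono i k : (i <= k)%N -> [set` F i] `<=` [set` F k].
  move=> /subnK <-; elim: (k - i)%N => // d IHd g /IHd /= gF.
  by rewrite inE gF orbT.
have f_F i k : (i < k)%N -> f i \in F k.
  by move=> /F_mono; apply; rewrite /= mem_head.
have size_f i k : (i <= k)%N -> (size (f i) <= size (f k))%N.
  move=> ik; apply: f_min; first exact: f_I.
  by move=> /(ideal_gen_mono (F_mono _ _ ik)); apply: fnF.
have f_neq0 k : (0 < size (f k))%N.
  rewrite lt0n size_poly_eq0; apply/eqP => fk0; apply: (fnF k).
  by rewrite fk0; case: (ideal_gen_ideal [set` F k]).
have [B [Bf /finite_seqP[s eB] fB]] := nR (range (fun k => lead_coef (f k))).
(* Finitely many leading coefficients generate all the others, so they occur before some index
   [m]. *)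
have [m mP] : exists m, forall a, a \in s ->
    exists2 i, (i < m)%N & lead_coef (f i) = a.
  have : [set` s] `<=` range (fun k => lead_coef (f k)) by rewrite -eB.
  elim: s {eB} => [|a s IHs] sB; first by exists 0%N.
  have [|m mP] := IHs; first by move=> b /= bs; apply: sB; rewrite /= inE bs orbT.
  have [|i _ fi] := sB a; first by rewrite /= mem_head.
  exists (maxn m i.+1) => b; rewrite inE => /orP[/eqP ->|/mP[j jm fj]].
    by exists i => //; rewrite leq_max ltnSn orbT.
  by exists j => //; rewrite leq_max jm.
pose d := (size (f m)).-1.
have dS : d.+1 = size (f m) by rewrite prednK.
(* Coefficients at degree [d] of members of degree at most [d]: an ideal of [R], which is shown to
   contain the leading coefficient of [f m]. *)
pose J := [set a | exists q, [/\ ideal_gen [set` F m] q, (size q <= d.+1)%N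
  & q`_d = a]].
have iF := ideal_gen_ideal [set` F m]; case: (iF) => F0 FD FM.
have iJ : is_ideal J.
  split=> [|a b [p [Fp sp pa]] [q [Fq sq qb]]|a b [q [Fq sq qb]]].
  - by exists 0; rewrite size_poly0 coef0.
  - exists (p + q); rewrite coefD pa qb; split=> //; first exact: FD.
    by rewrite (leq_trans (size_polyD _ _)) // geq_max sp.
  - exists (a%:P * q); rewrite coefCM qb; split=> //; first exact: FM.
    rewrite mul_polyC; exact: leq_trans (size_scale_leq _ _) sq.
have : J (lead_coef (f m)).
  apply: (ideal_gen_sub iJ _ (fB _ _)); last by exists m.
  (* The power of ['X] lifts [f i] to degree exactly [d], so that its leading coefficient lands at
     index [d]. *)
  rewrite eB => a /mP[i im <-]; exists ('X^(d.+1 - size (f i)) * f i).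
  have sd : (size (f i) <= d.+1)%N by rewrite dS size_f // ltnW.
  split.
  - by apply: FM; apply: sub_ideal_gen; apply: f_F.
  - apply: leq_trans (size_polyMleq _ _) _.
    by rewrite size_polyXn addSn /= subnK.
  - rewrite coefXnM ltnNge leq_subLR -add1n leq_add2r f_neq0 /= /lead_coef.
    congr (_`_ _); case: (size (f i)) (f_neq0 i) sd => // l _ ld.
    by rewrite add1n subSS subKn.
case=> q [Fq sq qd].
(* The difference loses its term of degree [d], yet stays in [I] and outside the ideal of [F m],
   against the minimality of [f m]. *)
have small : (size (f m - q)%R <= d)%N.
  apply/leq_sizeP => j; rewrite leq_eqVlt => /predU1P[<-|dj].
    by rewrite coefB qd subrr.
  by rewrite coefB !nth_default ?subrr ?(leq_trans sq) // -dS.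
suff : (size (f m) <= size (f m - q)%R)%N by rewrite -dS leqNgt ltnS small.
apply: f_min => [|Fg]; last first.
  by apply: (fnF m); rewrite -(subrK q (f m)); apply: FD.
case: (iI) => _ ID IM; apply: ID; first exact: f_I.
rewrite -mulN1r; apply: IM.
by apply: (ideal_gen_sub iI _ Fq); exact: FI.
Qed.

(** The ring is an iterated univariate polynomial ring, described only by its constants, its
    variables and the evaluation at each point [e]. *)
Lemma noetherian_var_ring (K : fieldType) (n : nat) :
  exists R : comNzRingType, noetherian R /\
  exists (c : K -> R) (X : nat -> R), forall e : nat -> K,
  exists phi : {rmorphism R -> K},
    (forall i, (i < n)%N -> phi (X i) = e i) /\ (forall a, phi (c a) = a).
Proof.
elim: n => [|n [R [nR [c [X XP]]]]].
  exists K; split; first exact: field_noetherian.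
  by exists id, (fun=> 0) => e; exists idfun.
exists {poly R}; split; first exact: hilbert_basis.
exists (fun a => (c a)%:P), (fun i => if i == n then 'X else (X i)%:P) => e.
have [phi [phiX phic]] := XP e.
have cphi : commr_rmorph phi (e n) by move=> a; apply: mulrC.
exists (horner_morph cphi); split=> [i|a] /=; last by rewrite horner_morphC.
rewrite ltnS leq_eqVlt; case: eqP => [->|_] /=; first by rewrite horner_morphX.
by move=> /phiX; rewrite horner_morphC.
Qed.

Lemma noetherian_finite_vars (K : fieldType) (I : finType) :
  exists R : comNzRingType, noetherian R /\
  exists (c : K -> R) (X : I -> R), forall e : I -> K,
  exists phi : {rmorphism R -> K},
    (forall i, phi (X i) = e i) /\ (forall a, phi (c a) = a).
Proof.
have [R [nR [c [X XP]]]] := noetherian_var_ring K #|I|.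
exists R; split=> //; exists c, (fun i => X (enum_rank i)) => e.
(* [nth] needs a default element of [I]; if [I] is empty, any evaluation will do. *)
case: (pickP (fun _ : I => true)) => [i0 _|I0]; last first.
  by have [phi [_ phic]] := XP (fun=> 0); exists phi; split=> // i; have := I0 i.
have [phi [phiX phic]] := XP (fun k => e (nth i0 (enum I) k)).
exists phi; split=> // i; rewrite phiX //; congr (e _).
by rewrite -(enum_val_nth i0) enum_rankK.
Qed.

(** * Linearity of the group action *)

Section RightModules.
Variables (K : comNzRingType) (G : groupType) (V : rightModType K G).

(** This is what lets scalars pass through the action of a group element. *)
Lemma ga_scalar_central (c : K) (p : groupAlgebra K G) :
  p * ga_scalar G c = ga_scalar G c * p.
Proof.
rewrite !ga_mulE [p]monalgE ga_mul_suml ga_mul_sumr.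
by apply: eq_bigr => g _; rewrite !ga_mulUU mulg1 mul1g mulrC.
Qed.

Lemma rep_act_linear (g : G) :
  linear ((fun v => rep_act v g) : underlyingK V -> underlyingK V).
Proof.
have actZ c (u : V) : rep_act (rep_scale c u) g = rep_scale c (rep_act u g).
  rewrite /rep_act /rep_scale !scalerA; congr (_ *: _).
  exact: esym (ga_scalar_central c (ga_elt K g)).
by move=> c u v; rewrite -[RHS]/(rep_scale c _ + _) -actZ;
  exact: (scalerDr (ga_elt K g : (groupAlgebra K G)^c) (rep_scale c u : V) v).
Qed.

End RightModules.

(** * Words and free modules in coordinates *)

Section WordCoordinates.
Variables (X Y : finType) (n : nat).

Definition word_mx (R : nzRingType) (A : Y * bool -> 'M[R]_n)
    (u : seq (Y * bool)) : 'M[R]_n :=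
  foldr (fun a N => A a *m N) 1%:M u.

(* The coordinates of the image of [w] under the homomorphism that sends each
   [x] to the row vector [U x] and lets each letter [a] act by [A a]. *)
Definition coord_row (K R : nzRingType) (c : K -> R)
    (U : X -> 'rV[R]_n) (A : Y * bool -> 'M[R]_n)
    (w : X -> {malg K[freeGroup Y]}) : 'rV[R]_n :=
  \sum_x \sum_(f <- msupp (w x)) c (w x)@_f *: (U x *m word_mx A (fgword f)).

Lemma map_word_mx (R S : nzRingType) (phi : {rmorphism R -> S}) A u :
  map_mx phi (word_mx A u) = word_mx (fun a => map_mx phi (A a)) u.
Proof.
by elim: u => [|a u IHu] /=; rewrite ?map_mx1 // map_mxM IHu.
Qed.

Lemma map_coord_row (K R S : nzRingType) (c : K -> R)
    (phi : {rmorphism R -> S}) U A w :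
  map_mx phi (coord_row c U A w) =
  coord_row (phi \o c) (fun x => map_mx phi (U x))
    (fun a => map_mx phi (A a)) w.
Proof.
rewrite raddf_sum; apply: eq_bigr => x _.
rewrite raddf_sum; apply: eq_bigr => f _.
by rewrite /= map_mxZ map_mxM map_word_mx.
Qed.

End WordCoordinates.

Section FreeBasis.
Variables (K : comNzRingType) (X Y : finType).

Definition free_basis (x : X) : freeRep K X Y :=
  ([ffun z => if z == x then 1 else 0] :
    {ffun X -> groupAlgebra K (freeGroup Y)}).

Lemma free_basis_sum (w : freeRep K X Y) :
  (w : underlyingK (freeRep K X Y)) =
  \sum_x \sum_(f <- msupp ((w : {ffun X -> {malg K[freeGroup Y]}}) x))
    ((w : {ffun X -> {malg K[freeGroup Y]}}) x)@_f *:
      (rep_act (free_basis x) f : underlyingK (freeRep K X Y)).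
Proof.
have ev_lin (z : X) : linear ((fun v : underlyingK (freeRep K X Y) =>
    (v : {ffun X -> {malg K[freeGroup Y]}}) z)).
  by move=> a u v; rewrite -freeRep_scaleE; exact: ffunE.
(* As a linear map, the component at [z] passes through both sums. *)
pose ev z : {linear underlyingK (freeRep K X Y) -> {malg K[freeGroup Y]}} :=
  HB.pack (fun v : underlyingK (freeRep K X Y) =>
    (v : {ffun X -> {malg K[freeGroup Y]}}) z)
    (GRing.isLinear.Build _ _ _ _ _ (ev_lin z)).
have ev_term z x f (a : K) :
    ev z (a *: (rep_act (free_basis x) f : underlyingK (freeRep K X Y))) =
    a *: (if z == x then << f >> else 0).
  rewrite linearZ /= freeRep_actE ffunE.
  by case: eqP; rewrite ?mul1r ?mul0r.
apply/ffunP => z; rewrite -[RHS]/(ev z _) linear_sum.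
rewrite (bigD1 z) // [LHS]monalgE -[LHS]addr0; congr (_ + _).
  rewrite linear_sum; apply: eq_bigr => f _.
  rewrite ev_term eqxx; apply/malgP => k.
  by rewrite mcoeffZ !mcoeffU mulrnAr mulr1.
apply/esym/big1 => x xz; rewrite linear_sum; apply: big1 => f _.
by rewrite ev_term eq_sym (negPf xz) scaler0.
Qed.

End FreeBasis.

(** * Homomorphisms in coordinates *)

Section Coordinates.
Variables (K : fieldType) (G : groupType) (V : rightModType K G) (n : nat).
Variable v2r : underlyingK V -> 'rV[K]_n.
Hypotheses (v2r_lin : linear v2r) (v2r_bij : bijective v2r).

Lemma rep_act_mx : exists M : G -> 'M[K]_n, forall (v : V) g,
  v2r (rep_act v g) = v2r v *m M g.
Proof.
have [r2v v2rK r2vK] := v2r_bij.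
have f_lin g : linear (fun r => v2r (rep_act (r2v r : V) g)).
  move=> c r s; rewrite -v2r_lin -rep_act_linear; congr (v2r (rep_act _ g)).
  by apply: (can_inj v2rK); rewrite v2r_lin !r2vK.
pose f g : {linear 'rV[K]_n -> 'rV[K]_n} :=
  HB.pack (fun r => v2r (rep_act (r2v r : V) g))
    (GRing.isLinear.Build _ _ _ _ _ (f_lin g)).
by exists (fun g => lin1_mx (f g)) => v g; rewrite mul_rV_lin1 /= v2rK.
Qed.

Variables (X Y : finType) (M : G -> 'M[K]_n).
Hypothesis v2r_act : forall (v : V) g, v2r (rep_act v g) = v2r v *m M g.

Lemma v2r_fg_lift (b : Y -> G) (v : V) (f : freeGroup Y) :
  v2r (rep_act v (fg_lift b f)) =
  v2r v *m word_mx (fun a => M (letter_val b a)) (fgword f).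
Proof.
rewrite /fg_lift; elim: (fgword f) v => [|a u IHu] v /=.
  by rewrite rep_act1 mulmx1.
by rewrite -rep_actM IHu v2r_act mulmxA.
Qed.

(** Expand [w] in the free basis; the universal property of the free group identifies [rep_beta h]
    with the lift of its values on generators. *)
Lemma v2r_rep_alpha (h : repHom (freeRep K X Y) V) (w : freeRep K X Y) :
  v2r (rep_alpha h w) =
  coord_row id (fun x => v2r (rep_alpha h (free_basis K Y x)))
    (fun a => M (letter_val (rep_beta h \o @fg_gen Y) a))
    (w : {ffun X -> {malg K[freeGroup Y]}}).
Proof.
pose F : {linear underlyingK V -> 'rV[K]_n} :=
  HB.pack v2r (GRing.isLinear.Build _ _ _ _ _ v2r_lin).
rewrite [in LHS](free_basis_sum w) -[v2r _]/(F _) !linear_sum.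
apply: eq_bigr => x _; rewrite !linear_sum; apply: eq_bigr => f _.
rewrite !linearZ /= rep_homP; congr (_ *: _).
by rewrite (@fg_lift_unique _ _ _ (rep_beta h) (fun=> erefl)) v2r_fg_lift.
Qed.

End Coordinates.

(** * From polynomial equations to finite subsets of [T] *)

Lemma ideal_ker (R S : comNzRingType) (phi : {rmorphism R -> S}) :
  is_ideal [set r | phi r = 0].
Proof.
split=> [|x y /= px py|a x /= px] /=; first exact: rmorph0.
  by rewrite rmorphD px py addr0.
by rewrite rmorphM px mulr0.
Qed.

Theorem mainTheorem8 (K : fieldType) (G : groupType) (V : rightModType K G)
    (finV : rep_finite_dim V) :
  action_type_geom_noetherian V.
Proof.
case: finV => n [[v2r v2r_lin v2r_bij]] X Y T.
have [M v2r_act] := rep_act_mx v2r_lin v2r_bij.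
have [R [nR [c [Z ZP]]]] :=
  noetherian_finite_vars K (X * 'I_n + (Y * bool) * 'I_n * 'I_n)%type.
pose U x : 'rV[R]_n := \row_j Z (inl (x, j)).
pose A a : 'M[R]_n := \matrix_(i, j) Z (inr (a, i, j)).
pose P (w : freeRep K X Y) : 'rV[R]_n :=
  coord_row c U A (w : {ffun X -> {malg K[freeGroup Y]}}).
(* Each [h] is a point of affine space, and [phi] evaluates there. *)
have evalP (h : repHom (freeRep K X Y) V) : exists phi : {rmorphism R -> K},
    forall w, v2r (rep_alpha h w) = map_mx phi (P w).
  have [phi [phiZ phic]] := ZP (fun i => match i with
    | inl (x, j) => v2r (rep_alpha h (free_basis K Y x)) 0 j
    | inr (a, i, j) => M (letter_val (rep_beta h \o @fg_gen Y) a) i j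
    end).
  exists phi => w; rewrite map_coord_row (v2r_rep_alpha v2r_lin v2r_act).
  congr (coord_row _ _ _ _); apply/funext => z /=.
  - by rewrite phic.
  - by apply/rowP => j; rewrite !mxE phiZ.
  - by apply/matrixP => i j; rewrite !mxE phiZ.
have [B [BT /finite_seqP[s eB] TB]] :=
  nR [set r | exists2 w, T w & exists j, P w 0 j = r].
(* Select for each equation in [B] an element of [T] having it as a coordinate; the value 0 outside
   [B] is a dummy. *)
have wit r : exists w, B r -> T w /\ exists j, P w 0 j = r.
  by have [/BT[w Tw Pw]|] := pselect (B r); [exists w|exists 0].
have [g gP] := choice wit.
exists (g @` B); split.
- by move=> _ [r /gP[Tg _] <-].
- by apply: finite_image; rewrite eB; apply: finite_seq.
apply/seteqP; split=> h hT w.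
- have v2r0 : v2r 0 = 0.
    by have := v2r_lin (-1) 0 0; rewrite !scaleN1r oppr0 addr0 addNr.
  have [phi phiP] := evalP h.
  move=> Tw /=; apply: (bij_inj v2r_bij); rewrite v2r0 phiP.
  apply/rowP => j; rewrite !mxE.
  have : ideal_gen B (P w 0 j) by apply: TB; exists w => //; exists j.
  (* The kernel of [phi] is an ideal, so it is enough that [phi] kills [B]; each [r] there is a
     coordinate of [P (g r)], and [h] kills [g r]. *)
  apply: (ideal_gen_sub (ideal_ker phi)) => r Br /=.
  have [Tg [i <-]] := gP r Br.
  have hg : rep_alpha h (g r) = 0 by apply: hT; exists r.
  by have /rowP/(_ i) := phiP (g r); rewrite hg v2r0 !mxE.
- by case=> r /gP[Tg _] <-; apply: hT.
Qed.
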